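(* Assume $(X,r)$ is a finite left non-degenerate idempotent set-theoretic solution of the Yang--Baxter equation. Then the following properties are satisfied: \begin{enumerate} \item there exists a binary operation $\cdot$ on $X$ so that $(X,\cdot)$ is a left cancellative simple semigroup; \item there exists a surjective mapping $q\colon X\to\Lambda$, where $\Lambda$ is the set of idempotents of $(X,\cdot)$; \item for each $x\in X$ there exists a permutation $\varphi_x\in\mathrm{Sym}(X)$ so that the following identities hold (for all $x,y,z\in X$): \begin{align*} \text{(i)}\quad&\varphi_x(y\cdot\varphi_y(z))=\varphi_x(y)\cdot\varphi_{x\cdot\varphi_x(y)}\varphi_{q(x\cdot\varphi_x(y))}(z),\\ \text{(ii)}\quad&\varphi_{q(x\cdot\varphi_x(y\cdot\varphi_y(z)))}(q(y\cdot\varphi_y(z)))=q\bigl(x\cdot\varphi_x(y)\cdot\varphi_{x\cdot\varphi_x(y)}(\varphi_{q(x\cdot\varphi_x(y))}(z))\bigr),\\ \text{(iii)}\quad&q(\varphi_{q(x\cdot\varphi_x(y))}(z))=q\bigl(\varphi_{x\cdot\varphi_x(y\cdot\varphi_y(z))}(q(y\cdot\varphi_y(z)))\bigr),\\ \text{(iv)}\quad&q(x\cdot\varphi_x(q(x)))=q(x); \end{align*} \item the solution $r$ has the form $r(x,y)=(x\cdot\varphi_x(y),\,q(x\cdot\varphi_x(y)))$. \end{enumerate} Conversely, if $(X,\cdot)$ is a finite left cancellative simple semigroup with the set of idempotents $\Lambda$, and there exist a surjective mapping $q\colon X\to\Lambda$ and permutations $\varphi_x\in\mathrm{Sym}(X)$,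 for $x\in X$, satisfying conditions (i)--(iv), then the formula $r(x,y)=(x\cdot\varphi_x(y),\,q(x\cdot\varphi_x(y)))$ yields a finite left non-degenerate idempotent solution $(X,r)$ of the Yang--Baxter equation.
   Context: A set-theoretic solution of the Yang--Baxter equation is a pair $(X,r)$ with $X$ a non-empty set and $r\colon X\times X\to X\times X$ a map satisfying $(r\times\mathrm{id})(\mathrm{id}\times r)(r\times\mathrm{id})=(\mathrm{id}\times r)(r\times\mathrm{id})(\mathrm{id}\times r)$. Write $r(x,y)=(\lambda_x(y),\rho_y(x))$. The solution is finite if $X$ is finite, left non-degenerate if every $\lambda_x\colon X\to X$ is bijective, and idempotent if $r^2=r$. A semigroup is simple if it has no proper non-empty two-sided ideals, and left cancellative if $a\cdot b=a\cdot c$ implies $b=c$. An idempotent of $(X,\cdot)$ is an element $e$ with $e\cdot e=e$. $\mathrm{Sym}(X)$ is the group of permutations of $X$. A juxtaposition such as $\varphi_a\varphi_b(z)$ denotes the composition $\varphi_a(\varphi_b(z))$.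
   Formalization: The converse fails with (iv) as printed (X=Z/2, q=0, φ_0=id, φ_1=swap gives r(x,y)=(y,0), not idempotent); the identity x·φ_x(q(x))=x, equivalent to r²=r, is added as a hypothesis of the converse and also proved in the forward part. *)

(* Defs.v *)
From mathcomp Require Import all_boot all_fingroup.

Set Implicit Arguments.
Unset Strict Implicit.
Unset Printing Implicit Defensive.

Section Solutions.

Variables (X : Type) (r : X * X -> X * X).

(* lam x y and rho y x are the two components of r (x, y). *)
Definition lam (x y : X) : X := (r (x, y)).1.
Definition rho (y x : X) : X := (r (x, y)).2.

Definition r_id (t : X * X * X) : X * X * X :=
  let: (x, y, z) := t in (lam x y, rho y x, z).
Definition id_r (t : X * X * X) : X * X * X :=
  let: (x, y, z) := t in (x, lam y z, rho z y).

Definition yang_baxter : Prop :=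
  forall t, r_id (id_r (r_id t)) = id_r (r_id (id_r t)).

Definition left_nondegenerate : Prop := forall x, bijective (lam x).

Definition idempotent_solution : Prop := forall p, r (r p) = r p.

End Solutions.

Section Semigroups.

Variables (X : finType) (op : X -> X -> X).

Definition two_sided_ideal (I : {set X}) : Prop :=
  forall a b, b \in I -> op a b \in I /\ op b a \in I.

Definition simple : Prop :=
  forall I : {set X}, I != set0 -> two_sided_ideal I -> I = [set: X].

Definition left_cancellative : Prop :=
  forall a b c, op a b = op a c -> b = c.

Definition left_cancellative_simple_semigroup : Prop :=
  [/\ associative op, left_cancellative & simple].

Definition idempotents : {set X} := [set e | op e e == e].

(* A surjective mapping from X to the set of idempotents, seen as a map into X
   whose image is that set. *)
Definition onto_idempotents (q : X -> X) : Prop :=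
  [set q x | x : X] = idempotents.

End Semigroups.

Section Identities.

Variables (X : finType) (op : X -> X -> X) (q : X -> X) (phi : X -> {perm X}).

Local Infix "⋅" := op (at level 40, left associativity).

Definition identity_i : Prop := forall x y z,
  phi x (y ⋅ phi y z)
  = phi x y ⋅ phi (x ⋅ phi x y) (phi (q (x ⋅ phi x y)) z).

Definition identity_ii : Prop := forall x y z,
  phi (q (x ⋅ phi x (y ⋅ phi y z))) (q (y ⋅ phi y z))
  = q (x ⋅ phi x y ⋅ phi (x ⋅ phi x y) (phi (q (x ⋅ phi x y)) z)).

Definition identity_iii : Prop := forall x y z,
  q (phi (q (x ⋅ phi x y)) z)
  = q (phi (x ⋅ phi x (y ⋅ phi y z)) (q (y ⋅ phi y z))).

Definition identity_iv : Prop := forall x, q (x ⋅ phi x (q x)) = q x.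

(* Identity (iv) without the outer q.  It implies identity_iv and is exactly
   the idempotency of the map twisted_map below, which identity_iv alone does
   not ensure: on the group Z/2, with q constant equal to 0, phi 0 the identity
   and phi 1 the transposition, identities (i)-(iv) hold, but twisted_map is
   (x, y) |-> (y, 0), which is not idempotent. *)
Definition identity_iv_strong : Prop := forall x, x ⋅ phi x (q x) = x.

Definition twisted_map (p : X * X) : X * X :=
  let: (x, y) := p in (x ⋅ phi x y, q (x ⋅ phi x y)).

End Identities.

(* Main.v *)
Require Import Defs.
From mathcomp Require Import all_boot all_fingroup ssralg zmodp.

(** Write [l x = lam r x].  Idempotency forces [r (x, y) = (l x y, q (l x y))]
    with [q x] the preimage of [x] under [l x], and the Yang-Baxter equation
    then amounts to [l x (l y z) = l u (l (q u) z)], where [u = l x y], together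
    with [q (q (l x w)) = q w].  By finiteness [q] permutes its image, hence
    [l (l x e) = l x] and [q (l x e) = e] for [e] in that image, so that
    [x |-> l x e'] is a bijection from the fibre of [q] over [e] to the one over
    [e'].  All fibres thus have the same size, and each contains exactly one
    element of the image of [q]: transporting a cyclic group to every fibre,
    with that element as zero, gives the operation
    [(g, a) (h, b) = (g + h, b)], whose idempotents form the image of [q].
    Any such operation works, with [phi x] the quotient of [l x] by the left
    translation by [x]. *)

Set Implicit Arguments.
Unset Strict Implicit.
Unset Printing Implicit Defensive.

Import GRing.Theory.

(** By finiteness, left translation by an element of the ideal is onto, so every element is a
    multiple of one in the ideal. *)
Lemma left_cancellative_simple (X : finType) (op : X -> X -> X) :
  left_cancellative op -> simple op.
Proof.
move=> opI I /set0Pn[a aI] idI; apply/setP=> y; rewrite inE.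
have opaI : injective (op a) by move=> b c; apply: opI.
by rewrite -(f_invF opaI y); have [] := idI (invF opaI y) a aI.
Qed.

Lemma idempotent_left_identity (X : finType) (op : X -> X -> X) e y :
  associative op -> left_cancellative op -> e \in idempotents op -> op e y = y.
Proof. by move=> opA opI; rewrite inE => /eqP ee; apply: (opI e); rewrite opA ee. Qed.

Section FibredOperation.

Variables (X : finType) (q : X -> X) (m : nat) (g : X -> 'I_m.+1).
Hypothesis g_inj : forall x y, q x = q y -> g x = g y -> x = y.
Hypothesis g_onto : forall y j, exists z, q z = q y /\ g z = j.
Hypothesis g_zero : forall x, g (q x) = 0%R.
Hypothesis q_onto : forall x, exists y, q (q y) = q x.

Lemma exists_fibred_operation :
  exists op : X -> X -> X,
    [/\ left_cancellative_simple_semigroup op, onto_idempotents op q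
      & forall x y, q (op x y) = q y].
Proof.
have exP x y : exists z, (q z == q y) && (g z == (g x + g y)%R).
  by have [z [qz gz]] := g_onto y (g x + g y)%R; exists z; rewrite qz gz !eqxx.
pose op x y := xchoose (exP x y).
have q_op x y : q (op x y) = q y by have /andP[/eqP] := xchooseP (exP x y).
have g_op x y : g (op x y) = (g x + g y)%R.
  by have /andP[_ /eqP] := xchooseP (exP x y).
have opI : left_cancellative op.
  move=> a b c eq_ab; apply: g_inj; first by rewrite -(q_op a b) eq_ab q_op.
  by apply: (addrI (g a)); rewrite -!g_op eq_ab.
exists op; split=> //.
  split=> //; last exact: left_cancellative_simple.
  by move=> x y z; apply: g_inj; rewrite ?q_op // !g_op addrA.
apply/setP=> e; rewrite inE; apply/imsetP/eqP=> [[x _ ->]|ee].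
  by apply: g_inj; rewrite ?q_op // g_op g_zero addr0.
(* An idempotent has coordinate zero, as does the element [q y] of its fibre, so the two
   coincide. *)
have [y qy] := q_onto e; exists y => //; apply: g_inj => //.
by rewrite g_zero; apply: (addrI (g e)); rewrite -g_op ee addr0.
Qed.

End FibredOperation.

Section LeftAction.

Variables (X : finType) (l : X -> X -> X) (q : X -> X).
Hypothesis l_inj : forall x, injective (l x).
Hypothesis l_q : forall x, l x (q x) = x.

Let map_lq (p : X * X) : X * X := (l p.1 p.2, q (l p.1 p.2)).

Lemma idempotent_lq : idempotent_solution map_lq.
Proof. by case=> x y; rewrite /map_lq /= l_q. Qed.

(** The first components give the law for [l]. Given that law, the second ones read
    [q w' = l (q w') (q w)] with [w = l y z] and [w' = l x w], and [l_q] identifies [q w] with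
    [q (q w')]. Both third components are then [q w]. *)
Lemma yang_baxter_lqP :
  yang_baxter map_lq <->
  (forall x y z, l x (l y z) = l (l x y) (l (q (l x y)) z)) /\
  (forall x w, q (q (l x w)) = q w).
Proof.
split=> [ybe | [ll qql] [[x y] z]].
  have ll x y z : l x (l y z) = l (l x y) (l (q (l x y)) z).
    by have [] := ybe (x, y, z).
  split=> // x w; have [z def_w] : exists z, w = l w z by exists (q w).
  have [_] := ybe (x, w, z); rewrite /rho /lam /= -ll -def_w => eq2 _.
  by apply: (@l_inj (q (l x w))); rewrite l_q.
rewrite /r_id /id_r /lam /rho /= -ll.
have qE : l (q (l x (l y z))) (q (l y z)) = q (l x (l y z)).
  by rewrite -(qql x (l y z)) l_q.
rewrite qE qql; congr (_, _).
by rewrite -(qql x (l y z)) ll qql.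
Qed.

Hypothesis ll : forall x y z, l x (l y z) = l (l x y) (l (q (l x y)) z).
Hypothesis qql : forall x w, q (q (l x w)) = q w.

(** Since [q w = q (q (l w w))], [q] maps its image onto itself, hence injectively by finiteness. *)
Lemma q_inj_image : {in [set q x | x : X] &, injective q}.
Proof.
apply/imset_injP; apply/eqP; congr #|pred_of_set _|.
apply/setP=> e; apply/imsetP/imsetP=> [[y /imsetP[x _ ->] ->]|[x _ ->]].
  by exists (q x).
by exists (q (l x x)); rewrite ?qql ?imset_f.
Qed.

Lemma q_l_image x y : q (l x (q y)) = q y.
Proof. by apply: q_inj_image; rewrite ?imset_f ?qql. Qed.

(** Write [z] as [l (q y) z']: since [q (l x (q y)) = q y], the law [ll] has the factor [l (q y)] on
    both sides. *)
Lemma l_l_image x y z : l (l x (q y)) z = l x z.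
Proof. by rewrite -(f_invF (@l_inj (q y)) z) [RHS]ll q_l_image. Qed.

Lemma exists_fibre_coordinate (x0 : X) :
  exists m (g : X -> 'I_m.+1),
    [/\ forall x y, q x = q y -> g x = g y -> x = y,
        forall y j, exists z, q z = q y /\ g z = j
      & forall x, g (q x) = 0%R].
Proof.
pose F := [set x | q x == q x0].
have F_t x : l x (q x0) \in F by rewrite inE q_l_image.
have cF : #|F|.-1.+1 = #|F| by apply/prednK/card_gt0P; exists (l x0 (q x0)).
(* [x] is numbered by its transport to the reference fibre [F]. *)
pose k x : 'I_#|F|.-1.+1 := inord (index (l x (q x0)) (enum F)).
have k_inj x y : q x = q y -> k x = k y -> x = y.
  move=> qxy /(congr1 (@nat_of_ord _)).
  have lt_idx z : index (l z (q x0)) (enum F) < #|F|.-1.+1.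
    by rewrite cF cardE index_mem mem_enum.
  rewrite !inordK // => /index_inj eq_t.
  (* The transport of [x] determines [l x], and [x = l x (q x)]. *)
  rewrite -(l_q x) -(l_q y) -qxy -(l_l_image x x0) -(l_l_image y x0).
  by rewrite eq_t // mem_enum.
have k_onto y j : exists z, q z = q y /\ k z = j.
  have lt_j : j < size (enum F) by rewrite -cardE -{2}cF.
  pose t := nth x0 (enum F) j.
  have : t \in F by rewrite -mem_enum mem_nth.
  rewrite inE => /eqP q_t.
  (* Transporting this element back to [F] yields [l t (q x0) = l t (q t) = t]. *)
  exists (l t (q y)); rewrite q_l_image; split=> //; rewrite /k l_l_image -q_t l_q.
  by rewrite /t index_uniq ?enum_uniq // inord_val.
(* [q (l x x)] is the element of the image of [q] in the fibre of [x] *)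
exists #|F|.-1, (fun x => k x - k (q (l x x)))%R.
have c_eq x y : q x = q y -> q (l x x) = q (l y y).
  by move=> qxy; apply: q_inj_image; rewrite ?imset_f // !qql.
split=> [x y qxy | y j | x].
- by rewrite (c_eq _ _ qxy) => /addIr; apply: k_inj.
- have [z [qz kz]] := k_onto y (j + k (q (l y y)))%R.
  by exists z; rewrite qz (c_eq _ _ qz) kz addrK.
- by rewrite q_l_image subrr.
Qed.

End LeftAction.

Theorem theorem3p10 (X : finType) (X_nonempty : 0 < #|X|) :
  (forall r : X * X -> X * X,
     yang_baxter r -> left_nondegenerate r -> idempotent_solution r ->
     exists op : X -> X -> X,
       left_cancellative_simple_semigroup op /\
       exists q : X -> X,
         onto_idempotents op q /\
         exists phi : X -> {perm X},
           [/\ identity_i op q phi, identity_ii op q phi,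
               identity_iii op q phi, identity_iv op q phi
             & identity_iv_strong op q phi] /\
           (forall x y : X,
              r (x, y) = (op x (phi x y), q (op x (phi x y)))))
  /\
  (forall (op : X -> X -> X) (q : X -> X) (phi : X -> {perm X}),
     left_cancellative_simple_semigroup op ->
     onto_idempotents op q ->
     [/\ identity_i op q phi, identity_ii op q phi,
         identity_iii op q phi, identity_iv op q phi
       & identity_iv_strong op q phi] ->
     [/\ yang_baxter (twisted_map op q phi),
         left_nondegenerate (twisted_map op q phi)
       & idempotent_solution (twisted_map op q phi)]).
Proof.
split=> [r ybe nd idem | op q phi [opA opI _] q_onto [Hi Hii _ _ Hiv]]; last first.
  have q_left x y : op (q x) y = y.
    by apply: idempotent_left_identity; rewrite // -q_onto imset_f.
  pose l x y := op x (phi x y).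
  have l_inj x : injective (l x) by move=> y z /opI; apply: perm_inj.
  have l_q x : l x (q x) = x := Hiv x.
  have l_qx x y : l (q x) y = phi (q x) y by rewrite /l q_left.
  have ll x y z : l x (l y z) = l (l x y) (l (q (l x y)) z).
    by rewrite l_qx /l Hi opA.
  have qql x w : q (q (l x w)) = q w.
    (* With [z = q w], (ii) reduces to [l (q (l x w)) (q w) = q (l x w)]. *)
    have E : phi (q (l x (l w (q w)))) (q (l w (q w)))
           = q (l (l x w) (phi (q (l x w)) (q w))) := Hii x w (q w).
    apply: (l_inj (q (l x w))); rewrite l_q l_qx.
    by rewrite -[X in _ = q (l _ X)]l_qx -ll l_q in E.
  have [_ Hybe] := yang_baxter_lqP l_inj l_q.
  split; first by case=> -[x y] z; exact: (Hybe (conj ll qql) (x, y, z)).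
  - by move=> x; apply: injF_bij; apply: l_inj.
  - by case=> x y; apply: (idempotent_lq l_q (x, y)).
have l_inj x : injective (lam r x) by apply: bij_inj.
pose q x := invF (l_inj x) x.
have l_q x : lam r x (q x) = x by apply: f_invF.
have rE x y : r (x, y) = (lam r x y, q (lam r x y)).
  rewrite [LHS]surjective_pairing; congr (_, _).
  (* With [u = lam r x y], idempotency says that [lam r u] sends the second component of [r (x, y)]
     to [u]. *)
  apply: (@l_inj (lam r x y)); rewrite l_q /lam -surjective_pairing.
  by rewrite idem.
have [ll qql] : (forall x y z, lam r x (lam r y z) =
      lam r (lam r x y) (lam r (q (lam r x y)) z)) /\
    (forall x w, q (q (lam r x w)) = q w).
  apply/(yang_baxter_lqP l_inj l_q) => -[[x y] z].
  by have := ybe (x, y, z); rewrite /r_id /id_r /rho !rE.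
have /card_gt0P[x0 _] := X_nonempty.
have [m [g [g_inj g_onto g_zero]]] := exists_fibre_coordinate l_inj l_q ll qql x0.
have q_onto x : exists y, q (q y) = q x by exists (lam r x x).
have [op [op_simple op_q q_op]] := exists_fibred_operation g_inj g_onto g_zero q_onto.
have [opA opI _] := op_simple.
have op_inj x : injective (op x) by move=> y z; apply: opI.
have phi_inj x : injective (fun y => invF (op_inj x) (lam r x y)).
  by move=> y z /(can_inj (f_invF (op_inj x))) /l_inj.
pose phi x := perm (@phi_inj x).
have op_phi x y : op x (phi x y) = lam r x y by rewrite permE f_invF.
have phi_q x y : phi (q x) y = lam r (q x) y.
  rewrite -op_phi idempotent_left_identity // -op_q; exact: imset_f.
exists op; split=> //; exists q; split=> //; exists phi; split; last first.
  by move=> x y; rewrite op_phi.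
split.
- by move=> x y z; apply: (opI x); rewrite opA !op_phi phi_q.
- by move=> x y z; rewrite !op_phi !phi_q -ll -(qql x (lam r y z)) l_q.
(* As [q] ignores left factors, [phi] may be replaced by [lam r] on the right; both sides equal
   [q (lam r y z)]. *)
- move=> x y z; rewrite !op_phi phi_q -[RHS](q_op (lam r x (lam r y z))) op_phi.
  by rewrite [RHS](q_l_image qql) -(qql x (lam r y z)) ll qql.
- by move=> x; rewrite op_phi l_q.
- by move=> x; rewrite op_phi l_q.
Qed.
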